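(* Let $(\mathcal M,\psi)$ be a probability space, let $\rho:\mathbb B_\infty\to\mathrm{Aut}(\mathcal M,\psi)$ be a representation and let $\mathcal M_{-1}\subset\mathcal M_0\subset\mathcal M_1\subset\cdots$ be a tower of $\psi$-conditioned subalgebras such that $\mathcal M=\bigvee_{n\ge-1}\mathcal M_n$. Suppose further that, for all $n\ge-1$, we have $$\mathcal M_n\subset\mathcal M_n^\rho,\qquad\text{where }\mathcal M_n^\rho:=\mathcal M^{\rho(\mathbb B_{n+2,\infty})},$$ and that $$\begin{matrix}\mathcal M_{n+1}&\subset&\mathcal M_{n+2}\\ \cup&&\cup\\ \mathcal M_n&\subset&\rho(\sigma_{n+2})(\mathcal M_{n+1})\end{matrix}$$ is a commuting square. Then $\mathcal M_n=\mathcal M_n^\rho$ for all $n\ge-1$.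
   Context: A probability space $(\mathcal M,\psi)$ is a von Neumann algebra $\mathcal M$ with separable predual together with a faithful normal state $\psi$. A von Neumann subalgebra $\mathcal B\subset\mathcal M$ is $\psi$-conditioned if the $\psi$-preserving conditional expectation $E_{\mathcal B}$ of $\mathcal M$ onto $\mathcal B$ exists. $\bigvee$ denotes the von Neumann algebra generated; $\mathrm{Aut}(\mathcal M,\psi)$ is the group of $\psi$-preserving automorphisms. A square of inclusions of $\psi$-conditioned subalgebras with top row $\mathcal N_2\subset\mathcal P$ and bottom row $\mathcal N\subset\mathcal N_1$ (so that also $\mathcal N\subset\mathcal N_2$ and $\mathcal N_1\subset\mathcal P$) is a commuting square if $E_{\mathcal N_1}E_{\mathcal N_2}=E_{\mathcal N}$. $\mathbb B_\infty$ is generated by $\sigma_1,\sigma_2,\dots$ subject to $\sigma_i\sigma_j\sigma_i=\sigma_j\sigma_i\sigma_j$ if $|i-j|=1$ and $\sigma_i\sigma_j=\sigma_j\sigma_i$ if $|i-j|>1$; $\mathbb B_{n,\infty}=\langle\sigma_k\mid k\ge n\rangle$; $\mathcal M^{\rho(\mathbb B_{n,\infty})}$ is the fixed point algebra of $\rho(\mathbb B_{n,\infty})$. *)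

(* Defs.v *)
From HB Require Import structures.
From mathcomp Require Import all_boot all_order all_algebra.
From mathcomp Require Import generic_quotient sesquilinear complex.
From mathcomp Require Import all_classical all_reals all_analysis.

Set Implicit Arguments.
Unset Strict Implicit.
Unset Printing Implicit Defensive.

Import Order.TTheory GRing.Theory Num.Theory.
Import numFieldNormedType.Exports.

Local Open Scope classical_set_scope.
Local Open Scope ring_scope.
Local Open Scope quotient_scope.
Local Open Scope complex_scope.

(* The infinite braid group, as words in the letters (i, b) modulo the        *)
(* congruence generated by the Artin relations: (i, false) stands for the     *)
(* generator sigma_{i+1} and (i, true) for its inverse.                       *)
Definition braid_word := seq (nat * bool).

Inductive braid_equiv : braid_word -> braid_word -> Prop :=
| be_refl u : braid_equiv u u
| be_sym u v : braid_equiv u v -> braid_equiv v u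
| be_trans u v w : braid_equiv u v -> braid_equiv v w -> braid_equiv u w
| be_cat u u' v v' :
    braid_equiv u u' -> braid_equiv v v' -> braid_equiv (u ++ v) (u' ++ v')
| be_inv i b : braid_equiv [:: (i, b); (i, ~~ b)] [::]
| be_braid i :
    braid_equiv [:: (i, false); (i.+1, false); (i, false)]
                [:: (i.+1, false); (i, false); (i.+1, false)]
| be_comm i j : (i.+1 < j)%N ->
    braid_equiv [:: (i, false); (j, false)] [:: (j, false); (i, false)].

Definition braid_eqb : rel braid_word := fun u v => `[< braid_equiv u v >].

Fact braid_eqb_equiv : equiv_class_of braid_eqb.
Proof.
split=> [u|u v|v u w].
- by apply/asboolP; exact: be_refl.
- by apply/asboolP/asboolP; exact: be_sym.
- by move=> /asboolP uv /asboolP vw; apply/asboolP; exact: be_trans uv vw.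
Qed.

Canonical braid_equiv_rel := EquivRelPack braid_eqb_equiv.

Definition braid_inf := {eq_quot braid_eqb}.
HB.instance Definition _ := Choice.on braid_inf.
HB.instance Definition _ := EqQuotient.on braid_inf.

Definition word_inv (u : braid_word) : braid_word :=
  rev [seq (p.1, ~~ p.2) | p <- u].

Definition braid_one : braid_inf := \pi_braid_inf [::].
Definition braid_mul (x y : braid_inf) : braid_inf :=
  \pi_braid_inf (repr x ++ repr y).
Definition braid_inv (x : braid_inf) : braid_inf :=
  \pi_braid_inf (word_inv (repr x)).

Lemma braid_piP u v :
  \pi_braid_inf u = \pi_braid_inf v <-> braid_equiv u v.
Proof. by split => [/eqmodP/asboolP|uv]; last exact/eqmodP/asboolP. Qed.

Lemma braid_repr u : braid_equiv (repr (\pi_braid_inf u)) u.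
Proof. by apply/braid_piP; rewrite reprK. Qed.

Lemma word_invl u : braid_equiv (word_inv u ++ u) [::].
Proof.
elim: u => [|[i b] u IH]; first exact: be_refl.
rewrite /word_inv /= rev_cons -cats1 -catA /=.
apply: be_trans IH; apply: be_cat; first exact: be_refl.
rewrite -[(i, b) :: u]/([:: (i, b)] ++ u) -cat1s catA -[X in braid_equiv _ X]cat0s.
apply: be_cat; last exact: be_refl.
by have := be_inv i (~~ b); rewrite negbK.
Qed.

Lemma word_invr u : braid_equiv (u ++ word_inv u) [::].
Proof.
have invK : word_inv (word_inv u) = u.
  rewrite /word_inv map_rev revK -map_comp -[RHS]map_id.
  by apply: eq_map => -[i b] /=; rewrite negbK.
by rewrite -{1}invK; exact: word_invl.
Qed.

Fact braid_mulA : associative braid_mul.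
Proof.
move=> x y z; apply/braid_piP.
apply: (@be_trans _ (repr x ++ (repr y ++ repr z))).
  by apply: be_cat; [exact: be_refl | exact: braid_repr].
rewrite catA; apply: be_cat; last exact: be_refl.
by apply: be_sym; exact: braid_repr.
Qed.

Fact braid_mul1 : left_id braid_one braid_mul.
Proof.
move=> x; rewrite -[RHS]reprK; apply/braid_piP.
rewrite -[X in braid_equiv _ X]cat0s.
by apply: be_cat; [exact: braid_repr | exact: be_refl].
Qed.

Fact braid_mulr1 : right_id braid_one braid_mul.
Proof.
move=> x; rewrite -[RHS]reprK; apply/braid_piP.
rewrite -[X in braid_equiv _ X]cats0.
by apply: be_cat; [exact: be_refl | exact: braid_repr].
Qed.

Fact braid_mulV : left_inverse braid_one braid_inv braid_mul.
Proof.
move=> x; apply/braid_piP; apply: be_trans (word_invl (repr x)).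
by apply: be_cat; [exact: braid_repr | exact: be_refl].
Qed.

Fact braid_mulrV : right_inverse braid_one braid_inv braid_mul.
Proof.
move=> x; apply/braid_piP; apply: be_trans (word_invr (repr x)).
by apply: be_cat; [exact: be_refl | exact: braid_repr].
Qed.

HB.instance Definition _ := isGroup.Build braid_inf
  braid_mulA braid_mul1 braid_mulr1 braid_mulV braid_mulrV.

(* Numbered from 0: sigma i is the Artin generator sigma_{i+1}. *)
Definition sigma (i : nat) : braid_inf := \pi_braid_inf [:: (i, false)].

Definition subgroup (G : groupType) (S : set G) : Prop :=
  [/\ S 1%g, forall x y, S x -> S y -> S (x * y)%g
    & forall x, S x -> S (x^-1)%g].

(* braid_tail n is B_{n+1,infty}, because of the shift in sigma. *)
Definition braid_tail (n : nat) : set braid_inf :=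
  smallest (@subgroup braid_inf) [set sigma k | k in [set k | (n <= k)%N]].

(* Von Neumann algebras are sets of bounded operators on a complex Hilbert    *)
(* space H, given by its norm and an inner product dot (linear in the first   *)
(* argument) inducing the norm. Operators are plain maps H -> H, added and    *)
(* scaled pointwise.                                                          *)
Section Operators.
Context (R : realType) (H : completeNormedModType R[i]).
Variable dot : {dot H for @Num.conj R[i]}.
Local Notation C := R[i].
Local Notation op := (H -> H).

Definition hilbert_space : Prop := forall x : H, `|x| ^+ 2 = dot x x.

Definition bounded_op (T : op) : Prop := linear T /\ continuous T.

Definition adjoint (T S : op) : Prop := forall x y, dot (T x) y = dot x (S y).

(* The adjoint is chosen among all maps; it is the usual one whenever T is a  *)
(* bounded operator.                                                          *)
Definition adj (T : op) : op := xget (0 : op) [set S | adjoint T S].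

Definition positive_op (T : op) : Prop := forall x, 0 <= dot (T x) x.

Definition commutant (S : set op) : set op :=
  [set T | bounded_op T /\ forall s, S s -> T \o s = s \o T].

Definition von_neumann (M : set op) : Prop :=
  [/\ M `<=` bounded_op,
      forall T, M T -> exists2 S, M S & adjoint T S
    & commutant (commutant M) = M].

Definition vn_generated (S : set op) : set op := smallest von_neumann S.

Definition linear_on (V : lmodType C) (M : set op) (f : op -> V) : Prop :=
  forall a x y, M x -> M y -> f (a *: x + y) = a *: f x + f y.

Definition square_summable (xi : nat -> H) : Prop :=
  cvgn (series (fun n => `|xi n| ^+ 2 : C^o)).

(* The seminorms defining the sigma-weak topology. *)
Definition sigma_weak_seminorm (xi eta : nat -> H) (x : op) : C :=
  `|limn (series (fun n => dot (x (xi n)) (eta n) : C^o))|.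

(* Continuity at 0 for the sigma-weak topology of M; as f is linear, this is  *)
(* continuity.                                                                *)
Definition sigma_weakly_continuous (M : set op) (f : op -> C) : Prop :=
  forall e : C, 0 < e ->
  exists (m : nat) (xi eta : 'I_m -> nat -> H) (d : C),
    [/\ 0 < d,
        forall k, square_summable (xi k) /\ square_summable (eta k)
      & forall x, M x -> (forall k, sigma_weak_seminorm (xi k) (eta k) x < d) ->
          `|f x| < e].

Definition predual (M : set op) : set (op -> C) :=
  [set f | linear_on M (f : op -> C^o) /\ sigma_weakly_continuous M f].

(* Functionals are compared on the unit ball of M, i.e. in the predual norm.  *)
Definition separable_predual (M : set op) : Prop :=
  exists f : nat -> op -> C, (forall k, predual M (f k)) /\
    forall g, predual M g -> forall e : C, 0 < e -> exists k, forall x, M x ->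
      (forall xi, `|x xi| <= `|xi|) -> `|g x - f k x| <= e.

Definition faithful_normal_state (M : set op) (psi : op -> C) : Prop :=
  [/\ predual M psi,
      forall x, M x -> 0 <= psi (adj x \o x),
      psi idfun = 1
    & forall x, M x -> psi (adj x \o x) = 0 -> x = 0].

Definition probability_space (M : set op) (psi : op -> C) : Prop :=
  [/\ von_neumann M, separable_predual M & faithful_normal_state M psi].

(* Maps on M are represented by total maps op -> op whose values outside M    *)
(* are irrelevant.                                                            *)
Definition cond_exp_prop (M : set op) (psi : op -> C) (B : set op)
    (E : op -> op) : Prop :=
  [/\ linear_on M E,
      forall x, M x -> B (E x) /\ psi (E x) = psi x,
      forall b, B b -> E b = b,
      forall x, M x -> positive_op (E (adj x \o x))
    & forall b c x, B b -> B c -> M x -> E (b \o x \o c) = b \o E x \o c].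

Definition conditioned (M : set op) (psi : op -> C) (B : set op) : Prop :=
  [/\ von_neumann B, B `<=` M & exists E, cond_exp_prop M psi B E].

(* The psi-preserving conditional expectation onto B is unique on M; this is  *)
(* meaningful only if B is conditioned.                                       *)
Definition cond_exp (M : set op) (psi : op -> C) (B : set op) : op -> op :=
  xget (0 : op -> op) [set E | cond_exp_prop M psi B E].

(*   N2 <= P           *)
(*   \/    \/          *)
(*   N  <= N1          *)
Definition commuting_square (M : set op) (psi : op -> C)
    (N2 P N N1 : set op) : Prop :=
  [/\ [/\ conditioned M psi N2, conditioned M psi P,
          conditioned M psi N & conditioned M psi N1],
      [/\ N2 `<=` P, N `<=` N1, N `<=` N2 & N1 `<=` P]
    & forall x, M x ->
        cond_exp M psi N1 (cond_exp M psi N2 x) = cond_exp M psi N x].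

Definition state_automorphism (M : set op) (psi : op -> C) (a : op -> op) :
    Prop :=
  [/\ set_bij M M a,
      linear_on M a,
      forall x y, M x -> M y -> a (x \o y) = a x \o a y,
      forall x, M x -> a (adj x) = adj (a x)
    & forall x, M x -> psi (a x) = psi x].

Definition braid_representation (M : set op) (psi : op -> C)
    (rho : braid_inf -> op -> op) : Prop :=
  (forall g, state_automorphism M psi (rho g)) /\
  forall g h x, M x -> rho (g * h)%g x = rho g (rho h x).

Definition fixed_points (M : set op) (rho : braid_inf -> op -> op)
    (S : set braid_inf) : set op :=
  [set x | M x /\ forall g, S g -> rho g x = x].

End Operators.

(* Main.v *)
From HB Require Import structures.
Require Import Defs.
From mathcomp Require Import all_boot all_order all_algebra.
From mathcomp Require Import sesquilinear complex ring lra.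
From mathcomp Require Import all_classical all_reals all_analysis.
Import Order.TTheory GRing.Theory Num.Theory numFieldNormedType.Exports.
Local Open Scope classical_set_scope.
Local Open Scope ring_scope.
Local Open Scope complex_scope.

(** Give M the real inner product <x, y> = Re psi (y* x). The conditional
    expectation E_k onto tower k is then the orthogonal projection onto tower k
    (cond_exp_inner), the braid generators act by isometries, and the k-th
    commuting square says that the compression of sigma k to tower k.+1 is E_k:
    <sigma_k y, z> = <y, E_k z> for y, z in tower k.+1 (braided_inner).

    Let x be fixed by sigma i for all i >= j and let y be in tower j.+1. The
    translates t_n = sigma_(j+n-1) ... sigma_j y satisfy <x, t_n> = <x, y>, while
    iterating the compression identity gives <z, t_n> = <z, E_j y> for every z in
    tower (j + n) (translate_inner). All t_n have the norm of y; so if x is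
    approximable by elements z of the tower, then <x, y> = <x, E_j y>
    (fixed_inner). Descending from tower (k + n) to tower k one level at a time,
    x - E_k x is orthogonal to the whole tower (fixed_orthogonal), and vanishes by
    density and faithfulness of psi (fixed_in_tower).

    The remaining point is the density of D, the union of the tower, in M for
    the norm of psi (sigma_weak_density). It is a form of the bicommutant theorem.
    A normal state is controlled by finitely many square-summable sequences of
    vectors, which interleave to one element xi of the Hilbert space l2 of
    square-summable sequences. The matrix entries of the projection of l2 onto
    the closure of D xi lie in the commutant of D, and so commute with M. Hence
    the projection fixes x xi for each x in M, and x xi is a limit of
    vectors z xi with z in D (bicommutant_approximation). That M commutes with
    these entries holds because the elements of M commuting with them and their
    adjoints already form a von Neumann algebra containing D
    (generated_commutes). *)

Set Implicit Arguments.
Unset Strict Implicit.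
Unset Printing Implicit Defensive.

(** * Semi-inner products and orthogonal projections *)

Section SemiInnerProducts.
Context {R : realType} {V : lmodType R[i]}.
Implicit Types (L K : set V) (r : V -> V -> R).

Definition lin_subspace L : Prop :=
  [/\ L 0, forall a b, L a -> L b -> L (a + b)
    & forall (c : R[i]) a, L a -> L (c *: a)].

(** A real-valued form on a complex vector space, required to behave only on a
    subspace: the forms of interest are given by formulas that make sense
    everywhere (limits of series, values of a state) but are bilinear only on
    the square-summable sequences, or on the von Neumann algebra. *)
Definition semi_inner L r : Prop :=
  [/\ forall a b c, L a -> L b -> L c -> r (a + b) c = r a c + r b c,
      forall (t : R) a b, L a -> L b -> r (t%:C *: a) b = t * r a b,
      forall a b, L a -> L b -> r a b = r b a
    & forall a, L a -> 0 <= r a a].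

Definition complete_for L r : Prop :=
  forall u : nat -> V, (forall n, L (u n)) ->
    (forall e, 0 < e -> exists N, forall m n, (N <= m)%N -> (N <= n)%N ->
       r (u m - u n) (u m - u n) <= e) ->
    exists2 l, L l &
      forall e, 0 < e -> exists N, forall n, (N <= n)%N ->
        r (u n - l) (u n - l) <= e.

(** p is the orthogonal projection of a onto the closure of K, membership in the
    closure being expressed as orthogonality to every vector orthogonal to K.
    In this form projections are carried along by any map with an adjoint
    (projects_map), without a bound on the map. *)
Definition projects_to L r K (a p : V) : Prop :=
  [/\ L p, forall q, L q -> (forall k, K k -> r k q = 0) -> r p q = 0
    & forall k, K k -> r (a - p) k = 0].

Lemma lin_subspaceN L a : lin_subspace L -> L a -> L (- a).
Proof. by case=> _ _ LZ La; rewrite -scaleN1r; exact: LZ. Qed.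

Lemma lin_subspaceB L a b : lin_subspace L -> L a -> L b -> L (a - b).
Proof.
move=> Ls La Lb; have [_ LD _] := Ls.
by apply: LD => //; exact: lin_subspaceN.
Qed.

Lemma quadratic_ge0 (A B C : R) : 0 <= C ->
  (forall t, 0 <= A - 2 * t * B + t ^+ 2 * C) -> B ^+ 2 <= A * C.
Proof.
rewrite le_eqVlt => /predU1P[<-{C} H|C0 H].
  rewrite mulr0; have [->|B0] := eqVneq B 0; first by rewrite expr0n.
  (* without a quadratic term, a nonzero B makes the affine function negative *)
  have := H ((A + 1) / (2 * B)); rewrite mulr0 addr0.
  have -> : 2 * ((A + 1) / (2 * B)) * B = A + 1 by field.
  lra.
have := H (B / C); have -> : A - 2 * (B / C) * B + (B / C) ^+ 2 * C =
  (A * C - B ^+ 2) / C by field; rewrite gt_eqF.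
by rewrite pmulr_lge0 ?invr_gt0// subr_ge0.
Qed.

Section Theory.
Context {L : set V} {r : V -> V -> R}.
Hypotheses (Ls : lin_subspace L) (ri : semi_inner L r).

Lemma semi_innerDl a b c : L a -> L b -> L c -> r (a + b) c = r a c + r b c.
Proof. by case: ri => + _ _ _; exact. Qed.

Lemma semi_innerC a b : L a -> L b -> r a b = r b a.
Proof. by case: ri => _ _ + _; exact. Qed.

Lemma semi_innerZl (t : R) a b : L a -> L b -> r (t%:C *: a) b = t * r a b.
Proof. by case: ri => _ + _ _; exact. Qed.

Lemma semi_inner_ge0 a : L a -> 0 <= r a a.
Proof. by case: ri => _ _ _; exact. Qed.

Lemma semi_innerDr a b c : L a -> L b -> L c -> r c (a + b) = r c a + r c b.
Proof.
move=> La Lb Lc; have [_ LD _] := Ls.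
rewrite semi_innerC ?semi_innerDl ?(@semi_innerC _ c)//; exact: LD.
Qed.

Lemma semi_innerNl a b : L a -> L b -> r (- a) b = - r a b.
Proof.
move=> La Lb; rewrite -scaleN1r.
have -> : -1 = (-1)%:C :> R[i] by rewrite rmorphN1.
by rewrite semi_innerZl// mulN1r.
Qed.

Lemma semi_innerBl a b c : L a -> L b -> L c -> r (a - b) c = r a c - r b c.
Proof.
move=> La Lb Lc; rewrite semi_innerDl ?semi_innerNl//; exact: lin_subspaceN.
Qed.

Lemma semi_innerBr a b c : L a -> L b -> L c -> r c (a - b) = r c a - r c b.
Proof.
move=> La Lb Lc; rewrite semi_innerC ?semi_innerBl ?(@semi_innerC _ c)//.
exact: lin_subspaceB.
Qed.

Lemma semi_innerBZ (t : R) a b : L a -> L b ->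
  r (a - t%:C *: b) (a - t%:C *: b) =
  r a a - 2 * t * r a b + t ^+ 2 * r b b.
Proof.
move=> La Lb; have [_ _ LZ] := Ls; have Ltb := LZ t%:C b Lb.
rewrite !(semi_innerBl, semi_innerBr)//; last exact: lin_subspaceB.
rewrite (@semi_innerC a (_ *: _))// !semi_innerZl// (@semi_innerC b (_ *: _))//.
by rewrite semi_innerZl// (@semi_innerC b a)//; ring.
Qed.

Lemma cauchy_schwarz a b : L a -> L b -> r a b ^+ 2 <= r a a * r b b.
Proof.
move=> La Lb; have [_ _ LZ] := Ls; apply: quadratic_ge0 => [|t].
  exact: semi_inner_ge0.
rewrite -semi_innerBZ//; apply: semi_inner_ge0.
by apply: lin_subspaceB => //; exact: LZ.
Qed.

Lemma sqr_small_eq0 (v B : R) : 0 <= B ->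
  (forall e, 0 < e -> v ^+ 2 <= e * B) -> v = 0.
Proof.
move=> B0 H; apply/eqP; rewrite -sqrf_eq0 eq_le sqr_ge0 andbT.
apply/ler_addgt0Pl => e e0; rewrite addr0.
have B1 : 0 < B + 1 by lra.
apply: le_trans (H (e / (B + 1)) (divr_gt0 e0 B1)) _.
by rewrite mulrAC ler_pdivrMr// ler_wpM2l ?lerDl// ltW.
Qed.

(** The shape in which density is used: if a can be replaced, on pairing with b,
    by arbitrarily small vectors, then it is orthogonal to b. *)
Lemma semi_inner_small a b : L a -> L b ->
  (forall e, 0 < e -> exists2 c, L c /\ r a b = r c b & r c c <= e) -> r a b = 0.
Proof.
move=> La Lb H; apply: (sqr_small_eq0 (semi_inner_ge0 Lb)) => e e0.
have [c [Lc ->] ce] := H e e0.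
by apply: le_trans (cauchy_schwarz Lc Lb) _; rewrite ler_wpM2r ?semi_inner_ge0.
Qed.

Lemma semi_innerB_le a b : L a -> L b ->
  r (a - b) (a - b) <= 2 * r a a + 2 * r b b.
Proof.
move=> La Lb; have [_ LD _] := Ls.
have := semi_inner_ge0 (LD _ _ La Lb); have Lab := lin_subspaceB Ls La Lb.
rewrite semi_innerDl ?semi_innerBl// ?semi_innerBr ?semi_innerDr//; [|exact: LD..].
by rewrite (semi_innerC Lb La); lra.
Qed.

Lemma parallelogram a k k' : L a -> L k -> L k' ->
  r (k - k') (k - k') = 2 * r (a - k) (a - k) + 2 * r (a - k') (a - k')
   - 4 * r (a - (2^-1)%:C *: (k + k')) (a - (2^-1)%:C *: (k + k')).
Proof.
move=> La Lk Lk'; have [_ LD LZ] := Ls; have Lkk := LD _ _ Lk Lk'.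
have LB x y : L x -> L y -> L (x - y) by exact: lin_subspaceB.
have Lak := LB _ _ La Lk; have Lak' := LB _ _ La Lk'; have Lkk' := LB _ _ Lk Lk'.
rewrite semi_innerBZ// !(semi_innerBl, semi_innerBr, semi_innerDl, semi_innerDr)//.
rewrite (@semi_innerC k a)// (@semi_innerC k' a)// (@semi_innerC k' k)//.
by field.
Qed.

(** The classical argument: a minimizing sequence in K is Cauchy by the
    parallelogram law, and its limit p is nearest to a, so moving along any k in
    K cannot decrease the distance. As p itself need not lie in K, the variation
    is made at the approximants, where it costs an error 1/(n+1). *)
Lemma projection_exists K a : complete_for L r -> lin_subspace K -> K `<=` L -> L a ->
  exists p, [/\ L p, forall e, 0 < e -> exists2 k, K k & r (k - p) (k - p) <= e
    & forall k, K k -> r (a - p) k = 0].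
Proof.
move=> cpl [K0 KD KZ] KL La; have [_ LD LZ] := Ls.
pose D := [set r (a - k) (a - k) | k in K].
have LB k : K k -> L (a - k) by move=> /KL; exact: lin_subspaceB.
have hD : has_inf D.
  split; first by exists (r (a - 0) (a - 0)), 0.
  by exists 0 => _ [k Kk <-]; exact/semi_inner_ge0/LB.
have Dinf k : K k -> inf D <= r (a - k) (a - k).
  by move=> Kk; apply: ge_inf; [case: hD | exists k].
have D0 : D !=set0 by case: hD.
have /choice[k kP] : forall n : nat, exists k, K k /\
    r (a - k) (a - k) <= inf D + n.+1%:R^-1.
  move=> n; have [] := @inf_adherent _ D (n.+1%:R^-1) _ hD.
    by rewrite invr_gt0.
  by move=> _ [k Kk <-] /ltW; exists k.
have small (e : R) : 0 < e -> exists N, forall n, (N <= n)%N -> n.+1%:R^-1 <= e.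
  move=> e0; exists (Num.truncn e^-1) => n Nn.
  rewrite invf_ple ?posrE//.
  apply: (@le_trans _ _ (Num.truncn e^-1).+1%:R); last by rewrite ler_nat ltnS.
  by apply/ltW/truncnS_gt.
have cau m n : r (k m - k n) (k m - k n) <= 2 * m.+1%:R^-1 + 2 * n.+1%:R^-1.
  have [Km rm] := kP m; have [Kn rn] := kP n.
  rewrite (parallelogram La (KL _ Km) (KL _ Kn)).
  have := Dinf _ (KZ (2^-1)%:C _ (KD _ _ Km Kn)).
  move: (r _ _) rm rn (r _ _) => A; move: (inf D) => I; move: (r _ _) => B.
  by move: (m.+1%:R^-1) (n.+1%:R^-1) => u v ? ? C ?; lra.
have [|e e0|p Lp kp] := cpl k; first by move=> n; apply/KL; case: (kP n).
  have [N NP] := small (e / 4) ltac:(by rewrite divr_gt0).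
  exists N => m n Nm Nn; apply: le_trans (cau m n) _.
  by move: (NP _ Nm) (NP _ Nn); move: (m.+1%:R^-1) (n.+1%:R^-1) => u v; lra.
exists p; split => // [e e0|h Kh].
  have [N /(_ N (leqnn _)) NP] := kp e e0; exists (k N) => //.
  by case: (kP N).
have Lk n : L (k n) by apply: KL; case: (kP n).
have Lh := KL _ Kh.
have ortho n : r (a - k n) h ^+ 2 <= n.+1%:R^-1 * r h h.
  apply: quadratic_ge0 => [|t]; first exact: semi_inner_ge0.
  have [Kn rn] := kP n.
  have := Dinf _ (KD _ _ Kn (KZ t%:C _ Kh)).
  rewrite opprD addrA semi_innerBZ//; last exact: lin_subspaceB.
  move: (r _ _) rn => A; move: (inf D) (n.+1%:R^-1) (r _ _) (r _ _) => I v B C.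
  by lra.
have hh := semi_inner_ge0 Lh.
have Lap : L (a - p) by exact: lin_subspaceB.
apply/eqP; rewrite -sqrf_eq0 eq_le sqr_ge0 andbT.
apply/ler_addgt0Pl => e e0; rewrite addr0.
have e40 : 0 < e / 4 / (r h h + 1) by rewrite !divr_gt0//; lra.
have [N1 N1P] := small _ e40.
have [N2 N2P] := kp _ e40.
pose n := maxn N1 N2.
have Lkp : L (k n - p) by exact: lin_subspaceB.
have -> : r (a - p) h = r (a - k n) h + r (k n - p) h.
  rewrite -semi_innerDl//; last exact: lin_subspaceB.
  by rewrite addrA subrK.
have key (x : R) : x <= e / 4 / (r h h + 1) -> x * r h h <= e / 4.
  move=> xe; apply: (@le_trans _ _ (e / 4 / (r h h + 1) * r h h)).
    by rewrite ler_wpM2r.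
  by rewrite mulrAC ler_pdivrMr; [nra | lra].
have := ortho n; have := key _ (N1P n (leq_maxl _ _)).
have := cauchy_schwarz Lkp Lh; have := key _ (N2P n (leq_maxr _ _)).
set x := r (a - k n) h; set y := r (k n - p) h.
move: (_^-1 * r h h) (_ * r h h) => u v ? ? ? ?.
have : (x + y) ^+ 2 <= 2 * x ^+ 2 + 2 * y ^+ 2.
  by have := sqr_ge0 (x - y); lra.
lra.
Qed.

Lemma approximable_projects K a p : K `<=` L -> L p ->
  (forall e, 0 < e -> exists2 k, K k & r (k - p) (k - p) <= e) ->
  (forall k, K k -> r (a - p) k = 0) -> projects_to L r K a p.
Proof.
move=> KL Lp approx ortho; split => // q Lq qK.
apply: semi_inner_small => // e /approx[k Kk ke].
have Lk := KL _ Kk; have Lpk := lin_subspaceB Ls Lp Lk.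
exists (p - k); first by split=> //; rewrite semi_innerBl// (qK k)// subr0.
suff -> : r (p - k) (p - k) = r (k - p) (k - p) by [].
have Lkp := lin_subspaceB Ls Lk Lp.
have LNkp := lin_subspaceN Ls Lkp.
by rewrite -(opprB k p) semi_innerNl// semi_innerC// semi_innerNl// opprK.
Qed.

Lemma projects_self K k : K `<=` L -> K k -> projects_to L r K k k.
Proof.
move=> KL Kk; split=> [|q Lq|h Kh]; first exact: KL; first exact.
have [L0 _ _] := Ls.
by rewrite subrr -(subrr 0) semi_innerBl ?subrr//; exact: KL.
Qed.

(** An orthogonal projection is self-adjoint. *)
Lemma projects_inner K a p b s : K `<=` L -> L a -> L b ->
  projects_to L r K a p -> projects_to L r K b s -> r p b = r a s.
Proof.
move=> KL La Lb [Lp pK ap] [Ls' sK bs].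
have Lap := lin_subspaceB Ls La Lp; have Lbs := lin_subspaceB Ls Lb Ls'.
have h1 : r p (b - s) = 0.
  by apply: pK => // k Kk; rewrite semi_innerC ?bs//; exact: KL.
have h2 : r s (a - p) = 0.
  by apply: sK => // k Kk; rewrite semi_innerC ?ap//; exact: KL.
move: h1 h2; rewrite !semi_innerBr// (semi_innerC Ls' La) (semi_innerC Ls' Lp).
by move=> /subr0_eq -> /subr0_eq ->.
Qed.

Lemma projects_unique K a p p' : K `<=` L -> L a ->
  projects_to L r K a p -> projects_to L r K a p' -> r (p - p') (p - p') = 0.
Proof.
move=> KL La [Lp pK ap] [Lp' p'K ap'].
have Lq := lin_subspaceB Ls Lp Lp'.
have qK k : K k -> r k (p - p') = 0.
  move=> Kk; have Lk := KL _ Kk.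
  have Lap := lin_subspaceB Ls La Lp; have Lap' := lin_subspaceB Ls La Lp'.
  have -> : p - p' = (a - p') - (a - p) by rewrite opprB [RHS]addrC subrKA.
  rewrite semi_innerBr// (semi_innerC Lk Lap) (semi_innerC Lk Lap').
  by rewrite ap// ap'// subrr.
by rewrite {1}semi_innerBl// pK// p'K// subrr.
Qed.

Lemma projects_contraction K a p : L a -> projects_to L r K a p -> K `<=` L ->
  r p p <= r a a.
Proof.
move=> La pap KL; have [Lp pK ap] := pap.
have Lap := lin_subspaceB Ls La Lp.
have /eqP : r p (a - p) = 0.
  by apply: pK => // k Kk; rewrite semi_innerC ?ap//; exact: KL.
rewrite semi_innerBr// subr_eq0 => /eqP pa.
have := semi_inner_ge0 Lap.
rewrite semi_innerBl// !semi_innerBr// (semi_innerC La Lp) pa subrr subr0.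
by rewrite subr_ge0.
Qed.

Lemma projectsD K a p b s : K `<=` L -> L a -> L b ->
  projects_to L r K a p -> projects_to L r K b s -> projects_to L r K (a + b) (p + s).
Proof.
move=> KL La Lb [Lp pK ap] [Ls' sK bs]; have [_ LD _] := Ls.
split=> [|q Lq qK|k Kk]; first exact: LD.
  by rewrite semi_innerDl// pK// sK// addr0.
have -> : a + b - (p + s) = (a - p) + (b - s) by rewrite opprD addrACA.
rewrite semi_innerDl ?ap ?bs ?addr0//; last exact: KL.
all: exact: lin_subspaceB.
Qed.

Lemma projects_map (T S : V -> V) K a p : K `<=` L -> L a ->
  (forall u, L u -> L (T u)) -> (forall u, L u -> L (S u)) ->
  (forall u v, T (u - v) = T u - T v) ->
  (forall u v, L u -> L v -> r (T u) v = r u (S v)) ->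
  (forall k, K k -> K (T k)) -> (forall k, K k -> K (S k)) ->
  projects_to L r K a p -> projects_to L r K (T a) (T p).
Proof.
move=> KL La LT LS TB TS KT KS [Lp pK ap].
split=> [|q Lq qK|k Kk]; first exact: LT.
  rewrite TS//; apply: pK => [|k Kk]; first exact: LS.
  by rewrite -TS ?qK//; [exact: KT|exact: KL].
rewrite -TB TS; [exact/ap/KS|exact: lin_subspaceB|exact: KL].
Qed.

End Theory.
End SemiInnerProducts.

(** * The real structure of the Hilbert space *)

Local Notation re := complex.Re.

Lemma re_realM {R : realType} (t : R) (z : R[i]) : re (t%:C * z) = t * re z.
Proof. by case: z => a b /=; rewrite mul0r subr0. Qed.

Lemma ge0_re {R : realType} (z : R[i]) : 0 <= z -> z = (re z)%:C.
Proof. by case: z => a b; rewrite lecE/= => /andP[/eqP->]. Qed.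

Lemma re_conj {R : realType} (z : R[i]) : re (Num.conj z) = re z.
Proof. by case: z. Qed.

Section HilbertSpace.
Context {R : realType} {H : completeNormedModType R[i]}.
Context {dot : {dot H for @Num.conj R[i]}}.
Hypothesis hilb : hilbert_space dot.
Implicit Types (T S : H -> H) (u v w : H).

Local Notation rdot := (fun u v : H => re (dot u v)).

Lemma semi_inner_rdot : semi_inner [set: H] rdot.
Proof.
split=> [a b c _ _ _|t a b _ _|a b _ _|a _].
- by rewrite linearDl raddfD.
- by rewrite linearZl_LR re_realM.
- by rewrite hermC/= expr0 mul1r re_conj.
- by have := dnorm_ge0 dot a; rewrite lecE => /andP[].
Qed.

Lemma rdotZ (c : R[i]) u v : re (dot (c *: u) v) = re (dot u (Num.conj c *: v)).
Proof. by rewrite linearZl_LR linearZr_LR/= conjCK. Qed.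

Lemma rdot_eq0 u : re (dot u u) <= 0 -> u = 0.
Proof.
move=> u0; apply/eqP; rewrite -(dnorm_eq0 dot) (ge0_re (dnorm_ge0 dot u)).
apply/eqP; congr (_%:C); apply/eqP; rewrite eq_le u0/=.
by have := dnorm_ge0 dot u; rewrite lecE => /andP[].
Qed.

Lemma sqr_norm_rdot u : `|u| ^+ 2 = (re (dot u u))%:C.
Proof. by rewrite hilb -ge0_re. Qed.

Lemma norm_le_rdot u (t : R) : 0 <= t ->
  (`|u| <= t%:C) = (re (dot u u) <= t ^+ 2).
Proof.
move=> t0; rewrite -(@ler_pXn2r _ 2)// ?nnegrE ?normr_ge0 ?lecR//.
by rewrite sqr_norm_rdot -rmorphXn/= lecR.
Qed.

Lemma complete_rdot : complete_for [set: H] rdot.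
Proof.
move=> u _ cau.
have : cauchy (u @ \oo).
  apply/cauchy_ballP => e e0; have eE := ge0_re (ltW e0).
  have re0 : 0 < re e by move: e0; rewrite {1}eE ltcR.
  have [|N NP] := cau ((re e / 2) ^+ 2); first by rewrite exprn_gt0// divr_gt0.
  pose tail := u @` [set n | (N <= n)%N].
  exists (tail, tail).
    by split; exists N => // n /= Nn; exists n.
  move=> [_ _]/= [[m Nm <-] [n Nn <-]].
  rewrite -ball_normE/=; apply: (@le_lt_trans _ _ (re e / 2)%:C).
    by rewrite norm_le_rdot ?NP// divr_ge0// ltW.
  by rewrite [ltRHS]eE ltcR; lra.
move=> /cauchy_cvgP/cvg_ex[l ul]; exists l => // e e0.
have s0 : 0 < Num.sqrt e by rewrite sqrtr_gt0.
have /cvgrPdist_le/(_ (Num.sqrt e)%:C) := ul; rewrite ltcR => /(_ s0)[N _ NP].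
exists N => n /NP; rewrite distrC norm_le_rdot ?sqrtr_ge0//.
by rewrite sqr_sqrtr// ltW.
Qed.

Lemma bounded_op_rdot T : bounded_op T ->
  exists2 B : R, 0 <= B & forall v, re (dot (T v) (T v)) <= B * re (dot v v).
Proof.
move=> [linT contT].
pose T' : {linear H -> H} := HB.pack T (GRing.isLinear.Build _ _ _ _ T linT).
have /linear_boundedP [M [Mr MP]] : bounded_near T' (nbhs 0).
  by apply/linear_bounded_continuous.
have rp : `|M| + 1 > M by apply: le_lt_trans (real_ler_norm Mr) _; rewrite ltrDl.
have M0 : 0 <= `|M| + 1 by rewrite addr_ge0.
exists (re (`|M| + 1) ^+ 2); first exact: sqr_ge0.
move=> v; rewrite -lecR rmorphM/= rmorphXn/= -(ge0_re M0) -!sqr_norm_rdot -exprMn.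
by rewrite ler_pXn2r// ?nnegrE ?mulr_ge0//; exact: MP.
Qed.

Lemma contraction_bounded_op T : linear T ->
  (forall v, re (dot (T v) (T v)) <= re (dot v v)) -> bounded_op T.
Proof.
move=> linT le1; split=> //.
pose T' : {linear H -> H} := HB.pack T (GRing.isLinear.Build _ _ _ _ T linT).
suff : continuous T' by [].
apply/linear_bounded_continuous/linear_boundedP.
exists 1; split => // x x1 v; apply: (@le_trans _ _ `|v|); last first.
  by rewrite ler_peMl// ltW.
by rewrite -(@ler_pXn2r _ 2)// ?nnegrE// !sqr_norm_rdot lecR.
Qed.

(** Passing to real parts loses nothing: the imaginary part of dot (T u) v is the
    real part at - i u. *)
Lemma rdot_adjoint T S : linear T ->
  (forall u v, re (dot (T u) v) = re (dot u (S v))) -> adjoint dot T S.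
Proof.
move=> linT TS u v.
have TZ c w : T (c *: w) = c *: T w.
  have T0 : T 0 = 0.
    have := linT 1 0 0; rewrite !scale1r addr0 => T00.
    by apply: (@addrI _ (T 0)); rewrite -T00 addr0.
  by have := linT c w 0; rewrite T0 !addr0.
have := TS u v; have := TS (- 'i%C *: u) v; rewrite TZ !linearZl_LR/=.
case: (dot (T u) v) => a b; case: (dot u (S v)) => c d /=.
by rewrite !oppr0 !mul0r !add0r !mulN1r !opprK => -> ->.
Qed.

Lemma bounded_opB T : bounded_op T -> forall u v, T (u - v) = T u - T v.
Proof.
move=> [linT _] u v; have := linT (-1) v u.
by rewrite !scaleN1r !(addrC (- _)).
Qed.

Lemma bounded_op0 T : bounded_op T -> T 0 = 0.
Proof. by move=> bT; rewrite -{1}(subrr (0 : H)) bounded_opB// subrr. Qed.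

End HilbertSpace.

(** * Square-summable sequences of vectors *)

Section SquareSummable.
Context {R : realType} {H : completeNormedModType R[i]}.
Context {dot : {dot H for @Num.conj R[i]}}.
Hypothesis hilb : hilbert_space dot.
Implicit Types (a b : nat -> H) (u v w : H).

Local Notation rdot u v := (re (dot u v)).

Definition l2 (a : nat -> H) : Prop :=
  exists B : R, forall N, \sum_(0 <= n < N) rdot (a n) (a n) <= B.

Definition l2_inner (a b : nat -> H) : R :=
  limn (series (fun n => rdot (a n) (b n))).

Let rs := @semi_inner_rdot R H dot.
Let HT : @lin_subspace R H [set: H]. Proof. by split. Qed.

Lemma rdot_ge0 u : 0 <= rdot u u.
Proof. exact: (semi_inner_ge0 rs). Qed.

Lemma rdotD_le u v : rdot (u + v) (u + v) <= 2 * rdot u u + 2 * rdot v v.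
Proof.
have := rdot_ge0 (u - v).
rewrite !(semi_innerBl HT rs, semi_innerBr HT rs, semi_innerDl rs, semi_innerDr HT rs)//.
by rewrite (semi_innerC rs (a := v) (b := u))//; lra.
Qed.

Lemma rdot_le u v : 2 * `|rdot u v| <= rdot u u + rdot v v.
Proof.
have := rdot_ge0 (u - v); have := rdot_ge0 (u + v).
rewrite !(semi_innerBl HT rs, semi_innerBr HT rs, semi_innerDl rs, semi_innerDr HT rs)//.
rewrite (semi_innerC rs (a := v) (b := u))// => h1 h2.
by have [_|_] := ger0P (re (dot u v)); lra.
Qed.

Lemma l2_series_nd a :
  nondecreasing_seq (series (fun n => rdot (a n) (a n))).
Proof. by apply: nondecreasing_series => n _ _; exact: rdot_ge0. Qed.

Lemma l2_cvg_sqr a : l2 a -> cvgn (series (fun n => rdot (a n) (a n))).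
Proof.
move=> [B aB]; apply: nondecreasing_is_cvgn; first exact: l2_series_nd.
by exists B => _ [N _ <-]; exact: aB.
Qed.

Lemma l2_cvg a b : l2 a -> l2 b -> cvgn (series (fun n => rdot (a n) (b n))).
Proof.
move=> /l2_cvg_sqr la /l2_cvg_sqr lb.
apply: (@normed_cvg R R^o); apply: series_le_cvg (is_cvg_seriesD la lb) => n.
- exact: normr_ge0.
- by rewrite addr_ge0 ?rdot_ge0.
- have := rdot_le (a n) (b n); rewrite fctE/=.
  by have := normr_ge0 (rdot (a n) (b n)); lra.
Qed.

Lemma l2_partial_le a N : l2 a ->
  \sum_(0 <= n < N) rdot (a n) (a n) <= l2_inner a a.
Proof.
move=> la; apply: (nondecreasing_cvgn_le (@l2_series_nd a)).
exact: l2_cvg_sqr.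
Qed.

Lemma l2_inner_le a (B : R) :
  (forall N, \sum_(0 <= n < N) rdot (a n) (a n) <= B) -> l2_inner a a <= B.
Proof.
move=> aB; apply: limr_le; first by apply: l2_cvg_sqr; exists B.
by apply: nearW => N; exact: aB.
Qed.

Lemma lin_subspace_l2 : @lin_subspace R (nat -> H) l2.
Proof.
split=> [|a b [A aA] [B bB]|c a [A aA]].
- by exists 0 => N; rewrite big1// => n _; rewrite linear0l.
- exists (2 * A + 2 * B) => N; apply: (@le_trans _ _
    (\sum_(0 <= n < N) (2 * rdot (a n) (a n) + 2 * rdot (b n) (b n)))).
    by apply: ler_sum => n _; exact: rdotD_le.
  by rewrite big_split/= -!mulr_sumr lerD// ler_pM2l.
- exists (re (c * Num.conj c) * A) => N.
  have cc : 0 <= c * Num.conj c := mul_conjC_ge0 c.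
  have cr : 0 <= re (c * Num.conj c) by have := cc; rewrite {1}(ge0_re cc) lecR.
  rewrite (eq_bigr (fun n => re (c * Num.conj c) * rdot (a n) (a n))); last first.
    move=> n _; rewrite -re_realM -(ge0_re cc) fctE linearZl_LR linearZr_LR/=.
    by rewrite mulrA.
  by rewrite -mulr_sumr ler_wpM2l.
Qed.

Lemma semi_inner_l2 : semi_inner l2 l2_inner.
Proof.
split=> [a b c la lb lc|t a b la lb|a b la lb|a la].
- rewrite -lim_seriesD; [|exact: l2_cvg..].
  congr (limn (series _)); apply/funext => n /=.
  by rewrite !fctE linearDl raddfD.
- rewrite /l2_inner -[t * _]/(t *: (_ : R^o)).
  rewrite -lim_seriesZ; last exact: l2_cvg.
  congr (limn (series _)); apply/funext => n /=.
  by rewrite !fctE linearZl_LR re_realM.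
- congr (limn (series _)); apply/funext => n /=.
  exact: (semi_innerC rs).
- by apply: le_trans (l2_partial_le 0 la); rewrite big_geq.
Qed.

Lemma l2_coord_le a n : l2 a -> rdot (a n) (a n) <= l2_inner a a.
Proof.
move=> la; apply: le_trans (l2_partial_le n.+1 la).
rewrite big_nat_recr//= lerDr sumr_ge0// => i _; exact: rdot_ge0.
Qed.

Lemma l2_inner_eq0 a : l2 a -> l2_inner a a = 0 -> a = 0.
Proof.
move=> la a0; apply/funext => n; apply: (@rdot_eq0 _ _ dot).
by rewrite -a0; exact: l2_coord_le.
Qed.

(** The coordinates of a Cauchy sequence converge. Comparing a k with a later
    term a j turns the Cauchy bound into a bound on each partial sum of
    a k - l, with an error in finitely many coordinates that vanishes for large
    j; the bound is therefore uniform in the length of the partial sum. *)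
Lemma l2_complete : complete_for l2 l2_inner.
Proof.
have l2B a b := @lin_subspaceB _ _ _ a b lin_subspace_l2.
move=> a la cau.
have coord n : exists l, forall e, 0 < e -> exists N, forall k, (N <= k)%N ->
    rdot (a k n - l) (a k n - l) <= e.
  have [e e0|l _ al] := @complete_rdot _ _ _ hilb (fun k => a k n) (fun _ => I).
    have [N NP] := cau e e0; exists N => m k Nm Nk; apply: le_trans (NP m k Nm Nk).
    exact: (@l2_coord_le (a m - a k) n (l2B _ _ (la m) (la k))).
  by exists l.
have {coord}[l lP] := choice coord.
have partial_small M e : 0 < e -> exists N, forall k, (N <= k)%N ->
    \sum_(0 <= n < M) rdot (a k n - l n) (a k n - l n) <= e.
  elim: M e => [|M IH] e e0; first by exists 0 => k _; rewrite big_geq// ltW.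
  have [N1 N1P] := IH (e / 2) ltac:(by rewrite divr_gt0).
  have [N2 N2P] := lP M (e / 2) ltac:(by rewrite divr_gt0).
  exists (maxn N1 N2) => k; rewrite geq_max => /andP[/N1P h1 /N2P h2].
  by rewrite big_nat_recr//= [leRHS](splitr e) lerD.
have tail e : 0 < e -> exists N, forall k, (N <= k)%N -> forall M,
    \sum_(0 <= n < M) rdot ((a k - l) n) ((a k - l) n) <= e.
  move=> e0; have [N NP] := cau (e / 4) ltac:(by rewrite divr_gt0).
  exists N => k Nk M.
  have [N' N'P] := partial_small M (e / 4) ltac:(by rewrite divr_gt0).
  pose j := maxn N N'.
  have h1 := l2_partial_le M (l2B _ _ (la k) (la j)).
  have h2 := NP k j Nk (leq_maxl _ _).
  have h3 := N'P j (leq_maxr _ _).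
  apply: (@le_trans _ _ (\sum_(0 <= n < M)
     (2 * rdot ((a k - a j) n) ((a k - a j) n) +
      2 * rdot (a j n - l n) (a j n - l n)))).
    apply: ler_sum => n _; apply: le_trans (rdotD_le _ _).
    by rewrite !fctE addrA subrK.
  by rewrite big_split/= -!mulr_sumr; lra.
have [N0 N0P] := tail 1 ltr01.
exists l.
  rewrite (_ : l = a N0 - (a N0 - l)); last by rewrite opprB addrC subrK.
  by apply: l2B => //; exists 1; exact: N0P.
move=> e e0; have [N NP] := tail e e0; exists N => n Nn.
by apply: l2_inner_le; exact: NP.
Qed.

Definition single (i : nat) (v : H) : nat -> H :=
  fun n => if n == i then v else 0.

Lemma sum_single (f : nat -> R) i N : (forall n, n != i -> f n = 0) ->
  (i < N)%N -> \sum_(0 <= n < N) f n = f i.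
Proof.
move=> f0 iN; rewrite (bigD1_seq i) ?mem_index_iota ?iota_uniq//=.
by rewrite big1 ?addr0.
Qed.

Lemma singleD i u v : single i (u + v) = single i u + single i v.
Proof.
apply/funext => n; rewrite -[RHS]/(single i u n + single i v n) /single.
by case: ifP => _; rewrite ?addr0.
Qed.

Lemma single_comp (T : H -> H) i v : T 0 = 0 -> T \o single i v = single i (T v).
Proof. by move=> T0; apply/funext => n; rewrite /single/=; case: ifP. Qed.

Lemma l2_single i v : l2 (single i v).
Proof.
exists (rdot v v) => N; have [iN|Ni] := ltnP i N.
  rewrite (sum_single (i := i))// /single ?eqxx// => n /negbTE ->.
  by rewrite linear0l.
rewrite big_nat big1 ?rdot_ge0// => n /= nN.
by rewrite /single ltn_eqF ?linear0l// (leq_trans nN).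
Qed.

Lemma l2_inner_single a i v : l2_inner a (single i v) = rdot (a i) v.
Proof.
apply/cvg_lim => //; apply: cvg_near_cst; exists i.+1 => // N /= iN.
rewrite /series/= (sum_single (i := i))// /single ?eqxx// => n /negbTE ->.
by rewrite linear0r.
Qed.

Lemma l2_comp T a : bounded_op T -> l2 a -> l2 (T \o a).
Proof.
move=> /(bounded_op_rdot hilb)[B B0 TB] [A aA]; exists (B * A) => N.
apply: (@le_trans _ _ (\sum_(0 <= n < N) B * rdot (a n) (a n))).
  by apply: ler_sum => n _; exact: TB.
by rewrite -mulr_sumr ler_wpM2l.
Qed.

Lemma l2_inner_adjoint T S a b : adjoint dot T S ->
  l2_inner (T \o a) b = l2_inner a (S \o b).
Proof.
move=> TS; congr (limn (series _)); apply/funext => n /=.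
by rewrite TS.
Qed.

End SquareSummable.

(** * The bicommutant theorem in amplified form *)

Section Amplification.
Context {R : realType} {H : completeNormedModType R[i]}.
Context {dot : {dot H for @Num.conj R[i]}}.
Hypothesis hilb : hilbert_space dot.
Context {D : set (H -> H)}.
Hypotheses (Dsub : lin_subspace D) (Dbounded : D `<=` @bounded_op R H).
Hypotheses (Did : D idfun) (Dcomp : forall S T, D S -> D T -> D (S \o T)).
Hypothesis Dadj : forall T, D T -> exists2 S, D S & adjoint dot T S.
Context {xi : nat -> H}.
Hypothesis l2xi : @l2 R H dot xi.

Local Notation rdot u v := (re (dot u v)).
Local Notation L := (@l2 R H dot).
Local Notation ip := (@l2_inner R H dot).
Local Notation Ls := (@lin_subspace_l2 R H dot).
Local Notation ri := (@semi_inner_l2 R H dot).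
Local Notation K := [set z \o xi | z in D].
Local Notation proj := (projects_to L ip K).

Lemma orbit_sub_l2 : K `<=` L.
Proof. by move=> _ [z Dz <-]; apply: (l2_comp hilb) => //; exact: Dbounded. Qed.

Lemma lin_subspace_orbit : @lin_subspace R (nat -> H) K.
Proof.
have [D0 DD DZ] := Dsub; split=> [|_ _ [y Dy <-] [z Dz <-]|c _ [z Dz <-]].
- by exists 0.
- by exists (y + z) => //; exact: DD.
- by exists (c *: z) => //; exact: DZ.
Qed.

Lemma orbit_comp z a : D z -> K a -> K (z \o a).
Proof. by move=> Dz [y Dy <-]; exists (z \o y) => //; exact: Dcomp. Qed.

(** Let P project l2 onto the closure of the orbit K of xi under D acting
    coordinatewise. K is stable under D and under adjoints, so P commutes with D
    and its matrix entries E i j (component i of P on vectors supported at j)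
    lie in the commutant of D. If x and its adjoint x' commute with these
    entries, then x commutes with P, and as xi lies in K,
    P (x xi) = x (P xi) = x xi. The computation is made on coordinates, by
    pairing with vectors supported at one index, so that no sum over the matrix
    entries has to be exchanged with x. The adjoint of E i j is E j i, whence the
    restriction to operators T with an adjoint in the commutant. *)
Lemma bicommutant_approximation x x' : bounded_op x -> bounded_op x' ->
  adjoint dot x x' ->
  (forall T S, commutant D T -> commutant D S -> adjoint dot T S ->
    x \o T = T \o x /\ x' \o T = T \o x') ->
  forall e, 0 < e -> exists2 z, D z &
    ip ((z \o xi) - (x \o xi)) ((z \o xi) - (x \o xi)) <= e.
Proof.
move=> bx bx' xx' comm.
have Kxi : K xi by exists idfun.
have KL := orbit_sub_l2.
have [_ LD LZ] := Ls.
have cpl := @l2_complete R H dot hilb.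
have /choice[P PP] a : exists p, L a -> proj a p.
  have [La|nLa] := pselect (L a); last by exists 0.
  have [p [Lp ap orth]] := projection_exists Ls ri cpl lin_subspace_orbit KL La.
  by exists p => _; exact: (approximable_projects Ls ri).
have uniq a p p' : L a -> proj a p -> proj a p' -> p = p'.
  move=> La ap ap'; apply: subr0_eq; apply: (@l2_inner_eq0 _ _ dot).
    by apply: lin_subspaceB Ls _ _; [case: ap|case: ap'].
  exact: (projects_unique Ls ri KL La).
have ls i v : L (single i v) := l2_single i v.
have projZ c a p : L a -> proj a p -> proj (c *: a) (c *: p).
  move=> La ap; apply: (projects_map Ls (T := fun u => c *: u)
    (S := fun u => Num.conj c *: u) (a := a) (p := p)) => //.
  - by move=> u; exact: LZ.
  - by move=> u; exact: LZ.
  - by move=> u v; exact: scalerBr.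
  - move=> u v _ _; congr (limn (series _)); apply/funext => n /=.
    exact: rdotZ.
  - by move=> k; have [_ _] := lin_subspace_orbit; apply.
  - by move=> k; have [_ _] := lin_subspace_orbit; apply.
have projD z a p : D z -> L a -> proj a p -> proj (z \o a) (z \o p).
  move=> Dz La ap; have [z' Dz' zz'] := Dadj Dz.
  have bz := Dbounded Dz; have bz' := Dbounded Dz'.
  apply: (projects_map Ls (T := fun u => z \o u) (S := fun u => z' \o u)
    (a := a) (p := p)) => //.
  - by move=> u; exact: (l2_comp hilb).
  - by move=> u; exact: (l2_comp hilb).
  - by move=> u v; apply/funext => n /=; rewrite !fctE/= bounded_opB.
  - by move=> u v _ _; exact: l2_inner_adjoint.
  - by move=> k; exact: orbit_comp.
  - by move=> k; exact: orbit_comp.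
pose E i j v := P (single j v) i.
have Elin i j : linear (E i j).
  move=> c u v; rewrite /E.
  suff -> : P (single j (c *: u + v)) = c *: P (single j u) + P (single j v) by [].
  apply: (uniq (single j (c *: u + v))); [exact: ls|exact/PP/ls|].
  rewrite singleD -(@single_comp _ _ ( *:%R c)) ?scaler0//.
  apply: (projectsD Ls ri) => //; [exact/LZ/ls|exact/projZ/PP/ls|exact/PP/ls].
have Eb i j : bounded_op (E i j).
  apply: (contraction_bounded_op hilb) => // v.
  have pv := PP _ (ls j v).
  apply: (@le_trans _ _ (ip (P (single j v)) (P (single j v)))).
    by apply: l2_coord_le; case: pv.
  apply: le_trans (projects_contraction Ls ri (ls j v) pv KL) _.
  by rewrite l2_inner_single /single eqxx.
have Eadj i j : adjoint dot (E i j) (E j i).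
  apply: rdot_adjoint => // u v; rewrite /E -l2_inner_single.
  rewrite (projects_inner Ls ri KL (ls j u) (ls i v) (PP _ (ls j u)) (PP _ (ls i v))).
  have Lp : L (P (single i v)) by case: (PP _ (ls i v)).
  rewrite (semi_innerC ri (ls j u) Lp) l2_inner_single.
  exact: (semi_innerC (@semi_inner_rdot _ _ dot)).
have Ecomm i j : commutant D (E i j).
  split=> // z Dz; apply/funext => v; rewrite /E/=.
  suff -> : P (single j (z v)) = z \o P (single j v) by [].
  have bz := Dbounded Dz.
  apply: (uniq (single j (z v))); [exact: ls|exact/PP/ls|].
  rewrite -(single_comp _ _ (bounded_op0 bz)).
  exact/projD/PP/ls.
have x'P i w : x' \o P (single i w) = P (single i (x' w)).
  apply/funext => j; rewrite -[RHS]/((E j i \o x') w).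
  by have [_ <-] := comm _ _ (Ecomm j i) (Ecomm i j) (Eadj j i).
have Lx : L (x \o xi) by exact: (l2_comp hilb).
have Lx' i w : L (x' \o P (single i w)).
  by apply: (l2_comp hilb) => //; case: (PP _ (ls i w)).
have [p [Lp ap orth]] := projection_exists Ls ri cpl lin_subspace_orbit KL Lx.
have xp := approximable_projects Ls ri KL Lp ap orth.
suff -> : x \o xi = p by move=> e /ap[_ [z Dz <-] ze]; exists z.
apply/esym/subr0_eq/funext => i.
apply: (@rdot_eq0 _ _ dot); rewrite -l2_inner_single.
set w := (p - _) i.
rewrite (semi_innerBl Ls ri)// subr_le0.
rewrite (projects_inner Ls ri KL Lx (ls i w) xp (PP _ (ls i w))).
rewrite (l2_inner_adjoint _ _ xx') x'P.
have xixi := projects_self Ls ri KL Kxi.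
rewrite -(projects_inner Ls ri KL l2xi (ls i (x' w)) xixi (PP _ (ls i (x' w)))).
by rewrite !l2_inner_single /= xx'.
Qed.

End Amplification.

(** * Commutants and von Neumann algebras *)

Section VonNeumannAlgebras.
Context {R : realType} {H : completeNormedModType R[i]}.
Context {dot : {dot H for @Num.conj R[i]}}.
Implicit Types (S T x y z : H -> H) (M N D : set (H -> H)).

Lemma op_addE T S u : (T + S) u = T u + S u. Proof. by []. Qed.

Lemma op_scaleE (c : R[i]) T u : (c *: T) u = c *: T u. Proof. by []. Qed.

Lemma bounded_opD T S : bounded_op T -> bounded_op S -> bounded_op (T + S).
Proof.
move=> [linT cT] [linS cS]; split=> [c u v|u].
  by rewrite !op_addE linT linS scalerDr addrACA.
by apply: cvgD; [exact: cT|exact: cS].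
Qed.

Lemma bounded_opZ (c : R[i]) T : bounded_op T -> bounded_op (c *: T).
Proof.
move=> [linT cT]; split=> [a u v|u].
  by rewrite !op_scaleE linT scalerDr !scalerA mulrC.
by apply: cvgZr; exact: cT.
Qed.

Lemma bounded_op_zero : bounded_op (0 : H -> H).
Proof.
split=> [a u v|u]; last exact: cvg_cst.
have z w : (0 : H -> H) w = 0 by [].
by rewrite !z scaler0 addr0.
Qed.

Lemma bounded_op_id : bounded_op (idfun : H -> H).
Proof. by split=> // u; exact: cvg_id. Qed.

Lemma bounded_op_comp T S : bounded_op T -> bounded_op S -> bounded_op (T \o S).
Proof.
move=> [linT cT] [linS cS]; split=> [c u v|u]; first by rewrite /= linS linT.
by apply: continuous_comp; [exact: cS|exact: cT].
Qed.

Lemma commutant_lin_subspace D : D `<=` @bounded_op R H ->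
  lin_subspace (commutant D).
Proof.
move=> Db; split=> [|S T [bS SD] [bT TD]|c T [bT TD]]; split.
- exact: bounded_op_zero.
- by move=> s Ds; apply/funext => u /=; rewrite [RHS]bounded_op0//; exact: Db.
- exact: bounded_opD.
- move=> s Ds; have [lins _] := Db _ Ds; apply/funext => u /=.
  rewrite op_addE /= op_addE -[S (s u)]/((S \o s) u) -[T (s u)]/((T \o s) u) SD// TD//=.
  by have := lins 1 (S u) (T u); rewrite !scale1r.
- exact: bounded_opZ.
- move=> s Ds; have bs := Db _ Ds; have [lins _] := bs; apply/funext => u /=.
  rewrite op_scaleE /= op_scaleE -[T (s u)]/((T \o s) u) TD//=.
  by have := lins c (T u) 0; rewrite (bounded_op0 bs) !addr0.
Qed.

Lemma commutant_id D : commutant D idfun.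
Proof. by split=> //; exact: bounded_op_id. Qed.

Lemma commutant_comp D S T : commutant D S -> commutant D T ->
  commutant D (S \o T).
Proof.
move=> [bS SD] [bT TD]; split; first exact: bounded_op_comp.
by move=> s Ds; rewrite -compA TD// compA SD// compA.
Qed.

Lemma commutant_bounded D : commutant D `<=` @bounded_op R H.
Proof. by move=> T []. Qed.

Lemma sub_bicommutant D : D `<=` @bounded_op R H -> D `<=` commutant (commutant D).
Proof.
by move=> Db d Dd; split=> [|T [_ TD]]; [exact: Db|rewrite TD].
Qed.

Lemma tricommutant D : D `<=` @bounded_op R H ->
  commutant (commutant (commutant D)) = commutant D.
Proof.
move=> Db; apply/seteqP; split; last exact/sub_bicommutant/commutant_bounded.
by move=> T [bT TD]; split=> // s Ds; apply: TD; exact: sub_bicommutant.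
Qed.

Lemma vn_lin_subspace M : von_neumann dot M -> lin_subspace M.
Proof.
by move=> [_ _ <-]; apply: commutant_lin_subspace; exact: commutant_bounded.
Qed.

Lemma vn_id M : von_neumann dot M -> M idfun.
Proof. by move=> [_ _ <-]; exact: commutant_id. Qed.

Lemma vn_comp M S T : von_neumann dot M -> M S -> M T -> M (S \o T).
Proof. by move=> [_ _ <-]; exact: commutant_comp. Qed.

Lemma adjoint_sym T S : adjoint dot T S -> adjoint dot S T.
Proof.
by move=> TS u v; rewrite hermC/= [in RHS]hermC/= !expr0 !mul1r TS.
Qed.

Lemma adjoint_unique T S S' : adjoint dot T S -> adjoint dot T S' -> S = S'.
Proof.
move=> TS TS'; apply/funext => v; apply: subr0_eq; apply/eqP.
rewrite -(dnorm_eq0 dot); set w := S v - S' v.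
by rewrite {2}/w linearBr/= -TS -TS' subrr.
Qed.

Lemma adj_eq T S : adjoint dot T S -> adj dot T = S.
Proof.
by move=> TS; apply: (adjoint_unique _ TS); exact: (xgetI _ TS).
Qed.

Lemma vn_adj M T : von_neumann dot M -> M T -> M (adj dot T).
Proof. by move=> [_ Madj _] /Madj[S MS TS]; rewrite (adj_eq TS). Qed.

Lemma vn_adjoint M T : von_neumann dot M -> M T -> adjoint dot T (adj dot T).
Proof. by move=> [_ Madj _] /Madj[S MS TS]; rewrite (adj_eq TS). Qed.

Lemma adjointD T T' S S' : adjoint dot T T' -> adjoint dot S S' ->
  adjoint dot (T + S) (T' + S').
Proof. by move=> TT SS u v; rewrite !op_addE linearDl linearDr/= TT SS. Qed.

Lemma adjointZ (c : R[i]) T T' : adjoint dot T T' ->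
  adjoint dot (c *: T) (Num.conj c *: T').
Proof. by move=> TT u v; rewrite !op_scaleE linearZl_LR linearZr_LR/= conjCK TT. Qed.

Lemma adjoint_comp T T' S S' : adjoint dot T T' -> adjoint dot S S' ->
  adjoint dot (T \o S) (S' \o T').
Proof. by move=> TT SS u v /=; rewrite TT SS. Qed.

(** The elements of M lie in the bicommutant of D, as far as operators T with an
    adjoint in the commutant are concerned. Those T form a set A closed under
    adjoints, so the elements of M commuting with A form a von Neumann algebra:
    it is the commutant of the union of A and the commutant of M, and its elements
    inherit from M the existence of adjoints. It contains D, hence M. *)
Lemma generated_commutes M D : von_neumann dot M -> D `<=` M ->
  M = vn_generated dot D ->
  forall x T S, M x -> commutant D T -> commutant D S -> adjoint dot T S ->
    x \o T = T \o x.
Proof.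
move=> vM DM Mgen x T S Mx DT DS TS.
pose A := [set T | commutant D T /\ exists2 S, commutant D S & adjoint dot T S].
have Ab : A `|` commutant M `<=` @bounded_op R H.
  by move=> U [[[]]|[]].
have [Mb _ MM] := vM.
have vN : von_neumann dot (commutant (A `|` commutant M)).
  split; [exact: commutant_bounded| |exact: tricommutant].
  move=> z [bz zA]; have Mz : M z.
    by rewrite -MM; split=> // s Ms; apply: zA; right.
  have Mz' := vn_adj vM Mz; have zz' := vn_adjoint vM Mz.
  exists (adj dot z) => //; split; first exact: Mb.
  move=> s [[Ds [s' Ds' ss']]|Ms]; last by case: Ms => _ sM; rewrite (sM _ Mz').
  apply: (@adjoint_unique (s' \o z)).
    by apply: adjoint_comp => //; exact: adjoint_sym.
  rewrite -zA; first by apply: adjoint_comp => //; exact: adjoint_sym.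
  by left; split=> //; exists s => //; exact: adjoint_sym.
have DN : D `<=` commutant (A `|` commutant M).
  move=> d Dd; split=> [|s [[[_ ->//]]|[_ ->//]]]; first exact/Mb/DM.
  exact: DM.
move: Mx; rewrite {1}Mgen => /(_ _ (conj vN DN))[_]; apply.
by left; split=> //; exists S.
Qed.

End VonNeumannAlgebras.

(** * Normal functionals and one square-summable sequence *)

Section Merging.
Context {R : realType} {H : completeNormedModType R[i]}.
Context {dot : {dot H for @Num.conj R[i]}}.
Implicit Types (a b : nat -> H).

Definition interleave a b : nat -> H := fun n => if odd n then b n./2 else a n./2.

(** What is kept of a being a subsequence of zeta: every nonnegative sum along a
    is bounded by one along zeta. *)
Definition dominates (zeta a : nat -> H) : Prop :=
  forall f : H -> R, (forall u, 0 <= f u) -> forall N, exists N',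
    \sum_(0 <= n < N) f (a n) <= \sum_(0 <= n < N') f (zeta n).

Lemma sum_interleave (f : H -> R) a b N : \sum_(0 <= n < N.*2) f (interleave a b n) =
  \sum_(0 <= n < N) f (a n) + \sum_(0 <= n < N) f (b n).
Proof.
elim: N => [|N IH]; first by rewrite !big_geq// addr0.
rewrite doubleS !big_nat_recr//= IH /interleave/= odd_double/= uphalf_double doubleK.
by rewrite addrACA addrA.
Qed.

Lemma l2_interleave a b : @l2 _ _ dot a -> @l2 _ _ dot b -> @l2 _ _ dot (interleave a b).
Proof.
move=> [A aA] [B bB]; exists (A + B) => N.
apply: (@le_trans _ _ (\sum_(0 <= n < N.*2)
    re (dot (interleave a b n) (interleave a b n)))); last first.
  by rewrite (sum_interleave (fun u => re (dot u u))) lerD.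
rewrite (@big_cat_nat _ _ _ N 0 N.*2)//= -?addnn ?leq_addr// lerDl.
by apply: sumr_ge0 => n _; exact: rdot_ge0.
Qed.

Lemma dominates_interleavel a b : dominates (interleave a b) a.
Proof.
move=> f f0 N; exists N.*2; rewrite sum_interleave lerDl.
by apply: sumr_ge0 => n _; exact: f0.
Qed.

Lemma dominates_interleaver a b : dominates (interleave a b) b.
Proof.
move=> f f0 N; exists N.*2; rewrite sum_interleave lerDr.
by apply: sumr_ge0 => n _; exact: f0.
Qed.

Lemma dominates_trans a b c : dominates a b -> dominates b c -> dominates a c.
Proof.
move=> ab bc f f0 N; have [N' h'] := bc f f0 N; have [N'' h''] := ab f f0 N'.
by exists N''; exact: le_trans h' h''.
Qed.

Lemma l2_family m (xi : 'I_m -> nat -> H) : (forall k, @l2 _ _ dot (xi k)) ->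
  exists2 zeta, @l2 _ _ dot zeta & forall k, dominates zeta (xi k).
Proof.
elim: m xi => [|m IH] xi lxi.
  by exists 0 => [|[]//]; have [] := @lin_subspace_l2 R H dot.
have [zeta lz zP] := IH (fun k => xi (lift ord0 k)) (fun k => lxi _).
exists (interleave (xi ord0) zeta); first exact: l2_interleave.
move=> k; case: (unliftP ord0 k) => [j ->|->]; last exact: dominates_interleavel.
exact: dominates_trans (dominates_interleaver _ _) (zP j).
Qed.

End Merging.

Section Density.
Context {R : realType} {H : completeNormedModType R[i]}.
Context {dot : {dot H for @Num.conj R[i]}}.
Hypothesis hilb : hilbert_space dot.

Lemma square_summable_l2 (xi : nat -> H) : square_summable xi -> @l2 _ _ dot xi.
Proof.
move=> /cvg_seq_bounded/pinfty_ex_gt0[B B0 xiB].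
exists (re B) => N; have /= := xiB N I.
rewrite /series/= (eq_bigr (fun n => (re (dot (xi n) (xi n)))%:C)); last first.
  by move=> n _; exact: sqr_norm_rdot.
rewrite -rmorph_sum/= ger0_norm; last first.
  by rewrite lecR; apply: sumr_ge0 => n _; exact: rdot_ge0.
by rewrite lecE/= => /andP[].
Qed.

Lemma norm_dot_le (u v : H) :
  `|dot u v| <= (re (dot u u) + re (dot v v))%:C.
Proof.
pose iu : H := ('i%C : R[i]) *: u.
have h1 := @rdot_le R H dot u v; have h2 := @rdot_le R H dot iu v.
have h3 : re (dot iu iu) = re (dot u u).
  rewrite linearZl_LR linearZr_LR/= mulrA.
  case: (dot u u) => a b /=.
  by rewrite !(mul0r,mulr0,mul1r,mulr1,subr0,sub0r,opprK,oppr0,addr0,add0r).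
have h4 : re (dot iu v) = - complex.Im (dot u v).
  by rewrite linearZl_LR/=; case: (dot u v) => a b /=; rewrite mul0r mul1r sub0r.
rewrite h3 h4 normrN in h2.
apply: (@le_trans _ _ (`|re (dot u v)| + `|complex.Im (dot u v)|)%:C); last first.
  by rewrite lecR; lra.
rewrite {1}(complexE (dot u v)) rmorphD/=; apply: le_trans (ler_normD _ _) _.
by rewrite normrM !normc_def/= !expr0n/= expr1n !addr0 add0r sqrtr1 mul1r !sqrtr_sqr.
Qed.

(** By convention limn is 0 on divergent sequences, so the bound holds there
    too. *)
Lemma norm_limn_lt (s : nat -> R[i]^o) (B d : R) : 0 <= B < d ->
  (forall N, `|s N| <= B%:C) -> `|limn s| < d%:C.
Proof.
move=> /andP[B0 Bd] sB; have [cs|ncs] := pselect (cvgn s); last first.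
  by rewrite dvgP// normr0 ltcR (le_lt_trans B0).
have e0 : 0 < ((d - B) / 2)%:C by rewrite ltcR divr_gt0// subr_gt0.
have /cvgrPdist_le/(_ _ e0)[N _ /(_ N (leqnn _)) sN] := cs.
rewrite -(subrK (s N) (limn s)); apply: le_lt_trans (ler_normD _ _) _.
by apply: le_lt_trans (lerD sN (sB N)) _; rewrite -rmorphD ltcR/=; lra.
Qed.

End Density.

(** * Density in the norm of a normal state *)

Section NormalStates.
Context {R : realType} {H : completeNormedModType R[i]}.
Context {dot : {dot H for @Num.conj R[i]}}.
Hypothesis hilb : hilbert_space dot.
Context {M : set (H -> H)} {psi : (H -> H) -> R[i]}.
Hypothesis vM : von_neumann dot M.

(** A neighbourhood of 0 on which psi is small involves finitely many pairs of
    sequences; the amplified bicommutant theorem is applied to the interleaving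
    zeta of all of them. For w = x - z each seminorm of w* w at a pair (xi, eta)
    is at most the sum of |w xi_n|^2 plus that of |w eta_n|^2, and each of these is
    bounded by the squared norm of w zeta. *)
Lemma sigma_weak_density (D : set (H -> H)) : sigma_weakly_continuous dot M psi ->
  lin_subspace D -> D idfun -> (forall S T, D S -> D T -> D (S \o T)) ->
  (forall T, D T -> exists2 S, D S & adjoint dot T S) -> D `<=` M ->
  M = vn_generated dot D ->
  forall x (e : R), M x -> 0 < e -> exists2 z, D z &
    `|psi (adj dot (x - z) \o (x - z))| < e%:C.
Proof.
move=> psiM Dsub Did Dcomp Dadj DM Mgen x e Mx e0.
have [m [xi [eta [d [d0 xieta psid]]]]] := psiM e%:C ltac:(by rewrite ltcR).
have [z1 lz1 dom1] := l2_family (fun k => square_summable_l2 hilb (xieta k).1).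
have [z2 lz2 dom2] := l2_family (fun k => square_summable_l2 hilb (xieta k).2).
pose zeta := interleave z1 z2; have lz := l2_interleave lz1 lz2.
have [Mb _ _] := vM; have bx := Mb _ Mx.
have bx' := Mb _ (vn_adj vM Mx); have xx' := vn_adjoint vM Mx.
have dE := ge0_re (ltW d0); have rd0 : 0 < re d by move: d0; rewrite {1}dE ltcR.
have comm T S : commutant D T -> commutant D S -> adjoint dot T S ->
    x \o T = T \o x /\ adj dot x \o T = T \o adj dot x.
  move=> DT DS TS; split; apply: (generated_commutes vM DM Mgen _ DT DS TS) => //.
  exact: (vn_adj vM).
have Db : D `<=` @bounded_op R H by move=> y /DM /Mb.
have [|z Dz zP] := @bicommutant_approximation _ _ _ hilb D Dsub Db Did Dcomp Dadj
  zeta lz x (adj dot x) bx bx' xx' comm (re d / 4).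
  by rewrite divr_gt0.
exists z => //; pose w := x - z.
have Mw : M w by exact: lin_subspaceB (vn_lin_subspace vM) Mx (DM _ Dz).
have ww' := vn_adjoint vM Mw.
have Mww := vn_comp vM (vn_adj vM Mw) Mw.
apply: psid => // k; rewrite dE.
have zw N : \sum_(0 <= n < N) re (dot (w (zeta n)) (w (zeta n))) <= re d / 4.
  have Lw : @l2 _ _ dot ((z \o zeta) - (x \o zeta)).
    apply: lin_subspaceB; first exact: lin_subspace_l2.
      by apply: (l2_comp hilb) => //; exact: Db.
    exact: (l2_comp hilb).
  apply: le_trans (le_trans (l2_partial_le N Lw) zP).
  apply: ler_sum => n _.
  have -> : (z \o zeta - (x \o zeta)) n = - w (zeta n).
    by rewrite -[RHS]/(- (x (zeta n) - z (zeta n))) opprB.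
  by rewrite linearNl linearNr opprK.
have f0 u : 0 <= re (dot (w u) (w u)) := rdot_ge0 (w u).
have sum_le a N : dominates (R := R) zeta a ->
    \sum_(0 <= n < N) re (dot (w (a n)) (w (a n))) <= re d / 4.
  by move=> /(_ _ f0 N)[N' /le_trans]; apply; exact: zw.
apply: (@norm_limn_lt _ _ (re d / 2)) => [|N].
  by rewrite divr_ge0 ?ltW//= ; lra.
apply: le_trans (ler_norm_sum _ _ _) _.
apply: (@le_trans _ _ (\sum_(0 <= n < N)
   (re (dot (w (xi k n)) (w (xi k n))) + re (dot (w (eta k n)) (w (eta k n)))))%:C).
  rewrite rmorph_sum/=; apply: ler_sum => n _.
  by rewrite /= (adjoint_sym ww'); exact: norm_dot_le.
rewrite lecR big_split/=.
have h1 := sum_le (xi k) N (dominates_trans (dominates_interleavel _ _) (dom1 k)).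
have h2 := sum_le (eta k) N (dominates_trans (dominates_interleaver _ _) (dom2 k)).
by lra.
Qed.

End NormalStates.

(** * The inner product of a faithful normal state *)

Section StateInnerProduct.
Context {R : realType} {H : completeNormedModType R[i]}.
Context {dot : {dot H for @Num.conj R[i]}}.
Context {M : set (H -> H)} {psi : (H -> H) -> R[i]}.
Hypotheses (vM : von_neumann dot M) (psi_state : faithful_normal_state dot M psi).
Implicit Types (x y z : H -> H) (B : set (H -> H)).

Lemma linear_onD {V : lmodType R[i]} (f : (H -> H) -> V) x y :
  linear_on M f -> M x -> M y -> f (x + y) = f x + f y.
Proof. by move=> fM Mx My; have := fM 1 x y Mx My; rewrite !scale1r. Qed.

Lemma linear_onZ {V : lmodType R[i]} (f : (H -> H) -> V) (c : R[i]) x :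
  linear_on M f -> M x -> f (c *: x) = c *: f x.
Proof.
move=> fM Mx; have [M0 _ _] := vn_lin_subspace vM.
have f0 : f 0 = 0.
  by apply: (@addrI _ (f 0)); rewrite -linear_onD// !addr0.
by have := fM c x 0 Mx M0; rewrite f0 !addr0.
Qed.

Definition state_inner (x y : H -> H) : R := re (psi (adj dot y \o x)).

Let psi_lin : linear_on M (psi : _ -> R[i]^o).
Proof. by case: psi_state => -[]. Qed.

Let psiD x y : M x -> M y -> psi (x + y) = psi x + psi y.
Proof. exact: (linear_onD psi_lin). Qed.

Let psiZ (c : R[i]) x : M x -> psi (c *: x) = c * psi x.
Proof. exact: (linear_onZ _ psi_lin). Qed.

Let adjM x y : M x -> M y -> M (adj dot y \o x).
Proof. by move=> Mx My; exact: (vn_comp vM (vn_adj vM My) Mx). Qed.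

Lemma vn_adjD x y : M x -> M y -> adj dot (x + y) = adj dot x + adj dot y.
Proof. by move=> Mx My; apply: adj_eq; apply: adjointD; exact: (vn_adjoint vM). Qed.

Lemma vn_adjZ (c : R[i]) x : M x -> adj dot (c *: x) = Num.conj c *: adj dot x.
Proof. by move=> Mx; apply: adj_eq; apply: adjointZ; exact: (vn_adjoint vM). Qed.

Lemma vn_linear x : M x -> linear x.
Proof. by case: vM => Mb _ _ /Mb[]. Qed.

Lemma vn_compD x y z : M x -> x \o (y + z) = (x \o y) + (x \o z).
Proof.
move=> /vn_linear lx; apply/funext => u /=.
by have := lx 1 (y u) (z u); rewrite !scale1r.
Qed.

Lemma vn_compZ (c : R[i]) x y : M x -> x \o (c *: y) = c *: (x \o y).
Proof.
move=> Mx; have [Mb _ _] := vM; apply/funext => u /=.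
by have := vn_linear Mx c (y u) 0; rewrite (bounded_op0 (Mb _ Mx)) !addr0.
Qed.

Let psi_ge0 x : M x -> 0 <= psi (adj dot x \o x).
Proof. by case: psi_state => _ + _ _; apply. Qed.

(** For w = x + i y the value psi (w* w) is real, and its imaginary part is the
    difference of the two sides. *)
Lemma state_innerC x y : M x -> M y -> state_inner x y = state_inner y x.
Proof.
move=> Mx My; have [M0 MD MZ] := vn_lin_subspace vM.
have MZy := MZ 'i%C y My; have Mx' := vn_adj vM Mx; have My' := vn_adj vM My.
have := psi_ge0 (MD _ _ Mx MZy).
rewrite vn_adjD// vn_adjZ//.
have -> : (adj dot x + Num.conj 'i%C *: adj dot y) \o (x + 'i%C *: y) =
   (adj dot x \o x + 'i%C *: (adj dot x \o y)) +
    (Num.conj 'i%C *: (adj dot y \o x) + (adj dot y \o y)).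
  rewrite -[LHS]/((adj dot x \o (x + 'i%C *: y)) +
      Num.conj 'i%C *: (adj dot y \o (x + 'i%C *: y))).
  rewrite !vn_compD// !vn_compZ// scalerDr scalerA; congr (_ + (_ + _)).
  have -> : Num.conj 'i%C * 'i%C = 1 :> R[i].
    by apply/eqP; rewrite eq_complex/= !mul0r mulN1r opprK mulr0 add0r addr0 !eqxx.
  by rewrite scale1r.
rewrite !psiD ?psiZ; do ?[exact: adjM|exact/MZ/adjM|apply: MD].
have := psi_ge0 Mx; have := psi_ge0 My; rewrite /state_inner.
case: (psi (_ x \o x)) => a a'; case: (psi (_ y \o y)) => b b'.
case: (psi (_ x \o y)) => c c'; case: (psi (_ y \o x)) => f f'.
rewrite !lecE/= => /andP[/eqP -> _] /andP[/eqP -> _] /andP[/eqP + _]; lra.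
Qed.

Lemma semi_inner_state : semi_inner M state_inner.
Proof.
have [M0 MD MZ] := vn_lin_subspace vM.
split=> [a b c Ma Mb Mc|t a b Ma Mb|a b Ma Mb|a Ma].
- rewrite /state_inner vn_compD ?psiD ?raddfD//; try exact: adjM.
  exact: (vn_adj vM).
- rewrite /state_inner vn_compZ ?psiZ ?re_realM//; first exact: adjM.
  exact: (vn_adj vM).
- exact: state_innerC.
- by have := psi_ge0 Ma; rewrite lecE => /andP[].
Qed.

Lemma state_inner_eq0 x : M x -> state_inner x x = 0 -> x = 0.
Proof.
move=> Mx x0; have [_ _ _] := psi_state; apply => //.
by rewrite (ge0_re (psi_ge0 Mx)); congr (_%:C).
Qed.

Lemma cond_expP B : conditioned dot M psi B ->
  cond_exp_prop dot M psi B (cond_exp dot M psi B).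
Proof. by move=> [_ _ [E EP]]; exact: (xgetI _ EP). Qed.

Lemma cond_exp_in B x : conditioned dot M psi B -> M x ->
  B (cond_exp dot M psi B x).
Proof. by move=> /cond_expP[_ + _ _ _] => /(_ x) + /[dup] Mx => /(_ Mx)[]. Qed.

Lemma cond_exp_id B b : conditioned dot M psi B -> B b ->
  cond_exp dot M psi B b = b.
Proof. by move=> /cond_expP[_ _ + _ _]; exact. Qed.

(** The conditional expectation is the orthogonal projection onto its range: by
    the bimodule property, psi (b* E x) = psi (E (b* x)) = psi (b* x). *)
Lemma cond_exp_inner B x b : conditioned dot M psi B -> M x -> B b ->
  state_inner (cond_exp dot M psi B x) b = state_inner x b.
Proof.
move=> cB Mx Bb; have [vB BM _] := cB; have [_ Epsi _ _ Ebim] := cond_expP cB.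
have Bb' := vn_adj vB Bb.
have E' : cond_exp dot M psi B (adj dot b \o x) =
    adj dot b \o cond_exp dot M psi B x := Ebim _ _ _ Bb' (vn_id vB) Mx.
rewrite /state_inner -E'; congr (re _).
by case: (Epsi (adj dot b \o x)) => //; apply: adjM => //; exact: BM.
Qed.

Lemma automorphism_in a x : state_automorphism dot M psi a -> M x -> M (a x).
Proof. by move=> [[aM _ _] _ _ _ _]; exact: aM. Qed.

Lemma automorphism_inner a x y : state_automorphism dot M psi a -> M x -> M y ->
  state_inner (a x) (a y) = state_inner x y.
Proof.
move=> [_ _ aM aadj apsi] Mx My; rewrite /state_inner -aadj// -aM//.
  by rewrite apsi//; exact: adjM.
exact: (vn_adj vM).
Qed.

End StateInnerProduct.

(** * Towers with commuting squares *)

Section BraidedTower.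
Context {R : realType} {H : completeNormedModType R[i]}.
Context {dot : {dot H for @Num.conj R[i]}}.
Context {M : set (H -> H)} {psi : (H -> H) -> R[i]}.
Context {tower : nat -> set (H -> H)} {s : nat -> (H -> H) -> (H -> H)}.
Hypotheses (vM : von_neumann dot M) (psi_state : faithful_normal_state dot M psi).
Hypothesis cond_tower : forall k, conditioned dot M psi (tower k).
Hypothesis tower_le : forall k, tower k `<=` tower k.+1.
Hypothesis s_aut : forall k, state_automorphism dot M psi (s k).
Hypothesis s_fix : forall k x, tower k x -> s k x = x.
Hypothesis square : forall k, commuting_square dot M psi
  (tower k.+1) (tower k.+2) (tower k) (s k @` tower k.+1).
Hypothesis tower_dense : forall x (e : R), M x -> 0 < e ->
  exists m, exists2 z, tower m z & @state_inner R H dot psi (x - z) (x - z) <= e.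

Local Notation ip := (@state_inner R H dot psi).
Local Notation E k := (cond_exp dot M psi (tower k)).

Let Ms := vn_lin_subspace vM.
Let ipi := semi_inner_state vM psi_state.

Let towerM k x : tower k x -> M x.
Proof. by have [_ + _] := cond_tower k; exact. Qed.

Let E_in k x : M x -> tower k (E k x).
Proof. exact: (cond_exp_in (cond_tower k)). Qed.

Let ME k x : M x -> M (E k x).
Proof. by move=> Mx; exact: (towerM (E_in k Mx)). Qed.

Let E_inner k x b : M x -> tower k b -> ip (E k x) b = ip x b.
Proof. exact: (cond_exp_inner vM (cond_tower k)). Qed.

Lemma tower_mono j m : (j <= m)%N -> tower j `<=` tower m.
Proof.
move=> /subnK <-; elim: (m - j)%N => [//|n IH] x /IH.
by rewrite addSn; exact: tower_le.
Qed.

(** The commuting square read as: the compression of s k to tower k.+1 is the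
    projection onto tower k. Indeed s k y lies in the corner N1 of the square, so
    z may be replaced by its projection to N1, which is E k z by the square, and
    s k is an isometry fixing E k z. *)
Lemma braided_inner k y z : tower k.+1 y -> tower k.+1 z ->
  ip (s k y) z = ip y (E k z).
Proof.
move=> Ty Tz; have My := towerM Ty; have Mz := towerM Tz.
have [[_ _ _ cN] _ sq] := square k.
have Msy := automorphism_in (s_aut k) My.
have := sq z Mz; rewrite (cond_exp_id (cond_tower k.+1) Tz) => Ez.
have sN : (s k @` tower k.+1) (s k y) by exists y.
rewrite (semi_innerC ipi Msy Mz) -(cond_exp_inner vM cN Mz sN) Ez.
rewrite -{1}(s_fix (E_in k Mz)) (automorphism_inner vM (s_aut k) (ME k Mz) My).
exact: (semi_innerC ipi (ME k Mz) My).
Qed.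

(** s (j + n - 1) ... s (j + 1) (s j y): a copy of y that moves away from every
    fixed level of the tower, except for its component in tower j. *)
Fixpoint translate j n (y : H -> H) : H -> H :=
  if n is n'.+1 then s (j + n') (translate j n' y) else y.

Lemma translate_in j n y : tower j.+1 y -> tower (j + n).+1 (translate j n y).
Proof.
move=> Ty; elim: n => [|n IH]; first by rewrite addn0.
have [_ [_ _ _ sub] _] := square (j + n).
by rewrite addnS; apply: sub; exists (translate j n y).
Qed.

Lemma translate_inner j n y z : tower j.+1 y -> tower (j + n) z ->
  ip (translate j n y) z = ip (E j y) z.
Proof.
move=> Ty; have My := towerM Ty; elim: n z => [|n IH] z.
  by rewrite addn0 => Tz; rewrite E_inner.
rewrite addnS => Tz; have Mz := towerM Tz.
rewrite /= braided_inner//; last exact: translate_in.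
rewrite IH; last exact: E_in.
have TE : tower (j + n) (E j y) by apply: (tower_mono (leq_addr _ _)); exact: E_in.
rewrite (semi_innerC ipi (ME j My) (ME _ Mz)) E_inner//.
exact: (semi_innerC ipi Mz (ME j My)).
Qed.

Lemma translate_fixed j n x y : M x -> (forall i, (j <= i)%N -> s i x = x) ->
  tower j.+1 y -> ip x (translate j n y) = ip x y.
Proof.
move=> Mx xs Ty; elim: n => [//|n IH] /=.
rewrite -{1}(xs (j + n)%N (leq_addr _ _)).
rewrite (automorphism_inner vM (s_aut _))//.
exact: (towerM (translate_in n Ty)).
Qed.

Lemma translate_norm j n y : tower j.+1 y ->
  ip (translate j n y) (translate j n y) = ip y y.
Proof.
move=> Ty; elim: n => [//|n IH] /=.
have Mt := towerM (translate_in n Ty).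
by rewrite (automorphism_inner vM (s_aut _)).
Qed.

(** A fixed x does not distinguish y from its translates, while an approximant z
    of x at level m only sees the component E j y of the translate past m. All
    translates have the norm of y, so the error made by replacing x by z is
    uniform. *)
Lemma fixed_inner j x y : M x -> (forall i, (j <= i)%N -> s i x = x) ->
  tower j.+1 y -> ip x y = ip x (E j y).
Proof.
move=> Mx xs Ty; have My := towerM Ty; have MEy := ME j My.
apply: subr0_eq; pose B := 2 * ip y y + 2 * ip (E j y) (E j y).
have B0 : 0 <= B.
  by rewrite addr_ge0// mulr_ge0// (semi_inner_ge0 ipi).
apply: (sqr_small_eq0 B0) => e e0.
have [m [z Tz ze]] := tower_dense Mx e0.
have Mz := towerM Tz; have Mxz := lin_subspaceB Ms Mx Mz.
have {}Tz := tower_mono (leq_addl j m) Tz.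
pose t := translate j m y; have Mt : M t := towerM (translate_in m Ty).
have -> : ip x y - ip x (E j y) = ip (x - z) (t - E j y).
  rewrite !(semi_innerBl Ms ipi) ?(semi_innerBr Ms ipi)//; last first.
    exact: lin_subspaceB.
  rewrite translate_fixed// (semi_innerC ipi Mz Mt) translate_inner//.
  by rewrite (semi_innerC ipi MEy Mz) subrr subr0.
apply: le_trans (cauchy_schwarz Ms ipi Mxz (lin_subspaceB Ms Mt MEy)) _.
apply: ler_pM => //; try exact: (semi_inner_ge0 ipi).
  by apply: (semi_inner_ge0 ipi); exact: lin_subspaceB.
by rewrite /B -(translate_norm m Ty); exact: (semi_innerB_le Ms ipi).
Qed.

Lemma fixed_orthogonal k n x y : M x -> (forall i, (k <= i)%N -> s i x = x) ->
  tower (k + n) y -> ip (x - E k x) y = 0.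
Proof.
move=> Mx xs; have MEx := ME k Mx; elim: n y => [|n IH] y Ty.
  rewrite addn0 in Ty; have My := towerM Ty.
  by rewrite (semi_innerBl Ms ipi)// E_inner// subrr.
rewrite addnS in Ty; have My := towerM Ty; have MEy := ME (k + n) My.
rewrite -(IH _ (E_in _ My)) !(semi_innerBl Ms ipi)//; congr (_ - _).
  by apply: fixed_inner => // i ki; apply: xs; exact: leq_trans (leq_addr _ _) ki.
rewrite (semi_innerC ipi MEx My) (semi_innerC ipi MEx MEy) E_inner//.
by apply: (tower_mono (leq_addr _ _)); exact: E_in.
Qed.

Lemma fixed_in_tower k x : M x -> (forall i, (k <= i)%N -> s i x = x) ->
  tower k x.
Proof.
move=> Mx xs; have MEx := ME k Mx; pose w := x - E k x.
have Mw : M w := lin_subspaceB Ms Mx MEx.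
suff /(state_inner_eq0 psi_state Mw)/subr0_eq -> : ip w w = 0 by exact: E_in.
apply: (semi_inner_small Ms ipi Mw Mw) => e e0.
have [m [z Tz ze]] := tower_dense Mw e0; have Mz := towerM Tz.
have Mwz := lin_subspaceB Ms Mw Mz; exists (w - z) => //; split=> //.
rewrite [RHS](semi_innerBl Ms ipi)// (semi_innerC ipi Mz Mw).
rewrite (fixed_orthogonal Mx xs (tower_mono (leq_addl k m) Tz)).
by rewrite subr0.
Qed.

End BraidedTower.

(** The union of the tower is a unital algebra stable under adjoints, being a
    directed union of such algebras. *)
Lemma tower_union_dense {R : realType} {H : completeNormedModType R[i]}
    {dot : {dot H for @Num.conj R[i]}} (M : set (H -> H))
    (psi : (H -> H) -> R[i]) (tower : nat -> set (H -> H)) :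
  hilbert_space dot -> von_neumann dot M -> faithful_normal_state dot M psi ->
  (forall k, conditioned dot M psi (tower k)) ->
  (forall k, tower k `<=` tower k.+1) ->
  M = vn_generated dot (\bigcup_k tower k) ->
  forall x (e : R), M x -> 0 < e -> exists m, exists2 z, tower m z &
    @state_inner R H dot psi (x - z) (x - z) <= e.
Proof.
move=> hilb vM psi_state ct tower_le Mgen x e Mx e0.
have vt k : von_neumann dot (tower k) by case: (ct k).
have st k := vn_lin_subspace (vt k).
have mono := tower_mono tower_le.
have [[psi_lin psi_cont] psi_ge0 _ _] := psi_state.
have DM : \bigcup_k tower k `<=` M by move=> z [k _]; case: (ct k) => _ + _; apply.
have [||||z [m _ Tz] ze] :=
  sigma_weak_density hilb vM psi_cont _ _ _ _ DM Mgen Mx e0.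
- split=> [|S T [i _ Si] [j _ Tj]|c T [i _ Ti]].
  + by exists 0%N => //; case: (st 0%N).
  + exists (maxn i j) => //; have [_ + _] := st (maxn i j); apply.
      exact: mono (leq_maxl _ _) _ Si.
    exact: mono (leq_maxr _ _) _ Tj.
  + by exists i => //; have [_ _] := st i; apply.
- by exists 0%N => //; exact: (vn_id (vt _)).
- move=> S T [i _ Si] [j _ Tj]; exists (maxn i j) => //.
  apply: (vn_comp (vt _)); first exact: mono (leq_maxl _ _) _ Si.
  exact: mono (leq_maxr _ _) _ Tj.
- move=> T [i _ Ti]; exists (adj dot T); last exact: (vn_adjoint (vt i)).
  by exists i => //; exact: (vn_adj (vt i)).
exists m, z => //; rewrite -lecR; apply/ltW/(le_lt_trans _ ze).
have Mxz : M (x - z).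
  by apply: (lin_subspaceB (vn_lin_subspace vM)) => //; apply: DM; exists m.
have p0 := psi_ge0 _ Mxz.
by rewrite ger0_norm// [leRHS](ge0_re p0).
Qed.

Unset Implicit Arguments.
Set Printing Implicit Defensive.

(* Indices are shifted by one: with n = k - 1 >= -1, tower k is M_n, sigma k is
   sigma_{n+2} and braid_tail k is B_{n+2,infty}. *)
Theorem corollaryA13 (R : realType) (H : completeNormedModType R[i])
    (dot : {dot H for @Num.conj R[i]})
    (M : set (H -> H)) (psi : (H -> H) -> R[i])
    (rho : braid_inf -> (H -> H) -> (H -> H))
    (tower : nat -> set (H -> H)) :
  hilbert_space dot ->
  probability_space dot M psi ->
  braid_representation dot M psi rho ->
  (forall k : nat, conditioned dot M psi (tower k)) ->
  (forall k : nat, tower k `<=` tower k.+1) ->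
  M = vn_generated dot (\bigcup_k tower k) ->
  (forall k : nat, tower k `<=` fixed_points M rho (braid_tail k)) ->
  (forall k : nat,
     commuting_square dot M psi
       (tower k.+1) (tower k.+2)
       (tower k)    (rho (sigma k) @` tower k.+1)) ->
  forall k : nat, tower k = fixed_points M rho (braid_tail k).
Proof.
move=> hilb [vM _ psi_state] [rho_aut _] ct tower_le Mgen fixed square k.
have tail_sigma j i : (j <= i)%N -> braid_tail j (sigma i).
  by move=> ji G [_ SG]; apply: SG; exists i.
apply/seteqP; split=> [|x [Mx xs]]; first exact: fixed.
apply: (fixed_in_tower (s := fun i => rho (sigma i)) vM psi_state ct tower_le) => //.
- by move=> j z /fixed[_]; apply; exact: tail_sigma.
- exact: (tower_union_dense hilb vM psi_state ct tower_le Mgen).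
- by move=> i ki; apply: xs; exact: tail_sigma.
Qed.
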